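(* Let $\Psi=(\psi_k)$ be a frame in a Hilbert space $\mathcal{H}_1$ with bounds $A,B$ and $\Phi=(\phi_k)$ a frame in a Hilbert space $\mathcal{H}_2$ with bounds $A',B'$. Let $\tilde\Psi,\tilde\Phi$ be their canonical dual frames. Then: 1. $\mathcal{O}^{(\Phi,\Psi)}\circ\mathcal{M}^{(\tilde\Phi,\tilde\Psi)}=\mathrm{Id}=\mathcal{O}^{(\tilde\Phi,\tilde\Psi)}\circ\mathcal{M}^{(\Phi,\Psi)}$, where $\mathrm{Id}$ is the identity of $\mathcal{B}(\mathcal{H}_1,\mathcal{H}_2)$. Therefore, for all $O\in\mathcal{B}(\mathcal{H}_1,\mathcal{H}_2)$, $$O=\sum_{k,j}\langle O\tilde\psi_j,\tilde\phi_k\rangle\,\phi_k\otimes_i\overline{\psi}_j,$$ meaning $Of=\sum_k\left(\sum_j\langle O\tilde\psi_j,\tilde\phi_k\rangle\langle f,\psi_j\rangle\right)\phi_k$ for all $f\in\mathcal{H}_1$. 2. $\mathcal{M}^{(\Phi,\Psi)}$ is injective and $\mathcal{O}^{(\Phi,\Psi)}$ is surjective. 3. If $\mathcal{H}_1=\mathcal{H}_2$, then $\mathcal{O}^{(\Psi,\tilde\Psi)}(\mathrm{Id}_{l^2})=\mathrm{Id}_{\mathcal{H}_1}$. 4. Let $\Xi=(\xi_k)$ be any frame in a Hilbert space $\mathcal{H}_3$ with canonical dual frame $\tilde\Xi$, and let $O:\mathcal{H}_3\to\mathcal{H}_2$ and $P:\mathcal{H}_1\to\mathcal{H}_3$ be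 bounded linear operators. Then $$\mathcal{M}^{(\Phi,\Psi)}(O\circ P)=\mathcal{M}^{(\Phi,\Xi)}(O)\cdot\mathcal{M}^{(\tilde\Xi,\Psi)}(P),$$ where $\cdot$ is the matrix product.
   Context: Hilbert spaces are complex and infinite-dimensional, with inner product linear in the first argument. All sequences are indexed by a countable set $K$ and $l^2=l^2(K)$. $\mathcal{B}(X,Y)$ is the space of bounded linear operators from $X$ to $Y$. Bounded operators on $l^2$ are identified with the infinite matrices that define them via $(Mc)_j=\sum_k M_{j,k}c_k$. A sequence $(\psi_k)$ in $\mathcal{H}$ is a frame with bounds $A,B>0$ if $A\|f\|^2\le\sum_k|\langle f,\psi_k\rangle|^2\le B\|f\|^2$ for all $f\in\mathcal{H}$. Its frame operator $S f=\sum_k\langle f,\psi_k\rangle\psi_k$ is bounded, positive and invertible, and its canonical dual frame is $\tilde\Psi=(\tilde\psi_k)=(S^{-1}\psi_k)$. The analysis operator is $C_\Psi f=(\langle f,\psi_k\rangle)_k\in l^2$ and the synthesis operator is $D_\Psi c=\sum_k c_k\psi_k$ for $c\in l^2$. For frames (or, more generally, Bessel sequences) $\Psi$ in $\mathcal{H}_1$ and $\Phi$ in $\mathcal{H}_2$: - $\mathcal{M}^{(\Phi,\Psi)}:\mathcal{B}(\mathcal{H}_1,\mathcal{H}_2)\to\mathcal{B}(l^2,l^2)$ is given by $(\mathcal{M}^{(\Phi,\Psi)}(O))_{m,n}=\langle O\psi_n,\phi_m\rangle$, i.e. $\mathcal{M}^{(\Phi,\Psi)}(O)=C_\Phi\circ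 O\circ D_\Psi$. - $\mathcal{O}^{(\Phi,\Psi)}:\mathcal{B}(l^2,l^2)\to\mathcal{B}(\mathcal{H}_1,\mathcal{H}_2)$ is given by $\mathcal{O}^{(\Phi,\Psi)}(M)h=\sum_k\left(\sum_j M_{k,j}\langle h,\psi_j\rangle\right)\phi_k$, i.e. $\mathcal{O}^{(\Phi,\Psi)}(M)=D_\Phi\circ M\circ C_\Psi$. For $f\in\mathcal{H}_2$, $g\in\mathcal{H}_1$, $f\otimes_i\overline{g}$ is the operator $h\mapsto\langle h,g\rangle f$ from $\mathcal{H}_1$ to $\mathcal{H}_2$. *)

(* Defs.v *)
From HB Require Import structures.
From mathcomp Require Import all_boot all_order all_algebra.
From mathcomp Require Import finmap complex.
From mathcomp Require Import all_classical all_reals all_analysis.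
From mathcomp.analysis Require showcase.summability.

Set Implicit Arguments.
Unset Strict Implicit.
Unset Printing Implicit Defensive.

Import Order.TTheory GRing.Theory Num.Theory.
Import numFieldNormedType.Exports.

Local Open Scope classical_set_scope.
Local Open Scope ring_scope.

(* The norm of a normed module over R[i] takes its values in R[i]; the inner
   product is linear in its first argument. *)
HB.mixin Record CompleteNormedModule_isHilbert (R : realType) H
    of CompleteNormedModule R[i] H := {
  inner : {dot H for Num.conj} ;
  inner_norm : forall x : H, inner x x = `|x| ^+ 2
}.

#[short(type="hilbertType")]
HB.structure Definition Hilbert (R : realType) :=
  {H of CompleteNormedModule_isHilbert R H & CompleteNormedModule R[i] H}.

Definition infinite_dim (F : nzRingType) (V : lmodType F) : Prop :=
  forall s : seq V, exists x : V,
    forall c : nat -> F, x != \sum_(i < size s) c i *: s`_i.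

(* The index set K carries no order, so every series is the limit of its finite
   partial sums along the finite subsets of K directed by inclusion. Scalar
   series are taken in R[i]^o, which is R[i] as a normed module over itself. *)
Definition has_sum (K : choiceType) (F : numDomainType) (V : normedModType F)
    (x : K -> V) (l : V) : Prop :=
  summability.partial_sum x @ summability.totally --> l.

Notation sumK := summability.sum.

Section sequences.
Context {R : realType} {K : countType}.
Implicit Types (c : K -> R[i]) (M N : K -> K -> R[i]).

Definition rnorm (V : normedModType R[i]) (x : V) : R := complex.Re `|x|.

Definition sqsum c : \bar R :=
  \esum_(k in [set: K]) ((rnorm (c k : R[i]^o)) ^+ 2)%:E.

Definition l2 : set (K -> R[i]) := [set c | (sqsum c < +oo)%E].

Definition l2norm c : R := Num.sqrt (fine (sqsum c)).

Definition matvec M c : K -> R[i] :=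
  fun j => sumK (fun k => M j k * c k : R[i]^o).

(* B(l2, l2), a bounded operator being identified with its matrix. *)
Definition Bl2 : set (K -> K -> R[i]) := [set M |
  [/\ forall c j, l2 c ->
        exists s, has_sum (fun k => M j k * c k : R[i]^o) s,
      forall c, l2 c -> l2 (matvec M c) &
      exists r : R, forall c, l2 c -> l2norm (matvec M c) <= r * l2norm c]].

Definition idmat : K -> K -> R[i] := fun m n => (m == n)%:R.

Definition matprod M N : K -> K -> R[i] :=
  fun m n => sumK (fun k => M m k * N k n : R[i]^o).

End sequences.

Definition Bop {R : realType} (H1 H2 : hilbertType R) : set (H1 -> H2) :=
  [set O | linear O /\ exists r : R, forall x, rnorm (O x) <= r * rnorm x].
Arguments Bop {R} H1 H2 _.

Section frames.
Context {R : realType} {K : countType}.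

Definition frame (H : hilbertType R) (psi : K -> H) (A B : R) : Prop :=
  [/\ 0 < A, 0 < B &
    forall f : H,
      ((A * rnorm f ^+ 2)%:E <= sqsum (fun k => inner f (psi k)) <=
       (B * rnorm f ^+ 2)%:E)%E].

Definition analysis_op (H : hilbertType R) (psi : K -> H) (f : H) : K -> R[i] :=
  fun k => inner f (psi k).

Definition synthesis_op (H : hilbertType R) (psi : K -> H) (c : K -> R[i]) : H :=
  sumK (fun k => c k *: psi k).

Definition frame_op (H : hilbertType R) (psi : K -> H) (f : H) : H :=
  sumK (fun k => inner f (psi k) *: psi k).

(* The frame operator of a frame is bijective, so that its partial inverse below
   is its inverse; the default value 0 is then irrelevant. *)
Definition canonical_dual (H : hilbertType R) (psi : K -> H) : K -> H :=
  fun k => 'pinv_(fun=> 0) [set: H] (frame_op psi) (psi k).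

Section two_spaces.
Variables H1 H2 : hilbertType R.

Definition matrix_of (phi : K -> H2) (psi : K -> H1) (O : H1 -> H2) :
    K -> K -> R[i] :=
  fun m n => inner (O (psi n)) (phi m).

Definition operator_of (phi : K -> H2) (psi : K -> H1) (M : K -> K -> R[i]) :
    H1 -> H2 :=
  fun h => synthesis_op phi (matvec M (analysis_op psi h)).

End two_spaces.
End frames.

(* Main.v *)
(* For Bessel sequences the matrix of an operator factors as
   M^(phi, psi)(O) = C_phi O D_psi, and O^(phi, psi)(M) = D_phi M C_psi, so all
   the identities reduce to the reconstruction formulas
   D_psi C_psi' = id = D_psi' C_psi for a frame psi and its canonical dual psi'.
   These hold because the frame operator S is self-adjoint and bijective:
   coercivity gives injectivity and a bounded inverse, and, for the step
   t = A / B ^ 2, the map f |-> f - t S f is a contraction since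
   |f - t S f| ^ 2 <= (1 - 2 t A + t ^ 2 B ^ 2) |f| ^ 2
                    = (1 - A ^ 2 / B ^ 2) |f| ^ 2;
   the fixed point of f |-> f + t (g - S f) then solves S f = g. *)
Require Import Defs.
From mathcomp Require Import all_boot all_order all_algebra.
From mathcomp Require Import finmap complex.
From mathcomp Require Import all_classical all_reals all_analysis.
From mathcomp.analysis Require Import showcase.summability.
From mathcomp Require Import ring lra.
Set Implicit Arguments.
Unset Strict Implicit.
Unset Printing Implicit Defensive.
Import Order.TTheory GRing.Theory Num.Theory.
Import numFieldNormedType.Exports.
Local Open Scope classical_set_scope.
Local Open Scope ring_scope.

Lemma ltr0c (R : realType) (k : R) : (0 < k%:C%C) = (0 < k).
Proof. exact: (ltcR 0 k). Qed.

#[local] Existing Instance totally_filter.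

(** * Real-valued norms of vectors and of complex scalars *)

Section rnorm.
Context {R : realType} {V : normedModType R[i]}.
Implicit Types x y : V.

Lemma rnormE x : (rnorm x)%:C%C = `|x|.
Proof. by rewrite /rnorm RRe_real// ger0_real. Qed.

Lemma rnorm_ge0 x : 0 <= rnorm x.
Proof. by rewrite -ler0c rnormE. Qed.

Lemma rnorm0 : rnorm (0 : V) = 0.
Proof. by rewrite /rnorm normr0. Qed.

Lemma rnorm_eq0 x : rnorm x = 0 -> x = 0.
Proof. by move=> x0; apply/normr0_eq0; rewrite -rnormE x0. Qed.

Lemma rnormB x y : rnorm (x - y) = rnorm (y - x).
Proof. by rewrite /rnorm distrC. Qed.

Lemma ler_rnormD x y : rnorm (x + y) <= rnorm x + rnorm y.
Proof. by rewrite -lecR rmorphD/= !rnormE ler_normD. Qed.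

Lemma rnormZ (a : R[i]) x : rnorm (a *: x) = rnorm (a : R[i]^o) * rnorm x.
Proof. by apply: complexI; rewrite rmorphM/= !rnormE normrZ. Qed.

Lemma rnorm_small x : (forall e, 0 < e -> rnorm x <= e) -> x = 0.
Proof.
move=> xe; apply: rnorm_eq0; apply/eqP; rewrite eq_le rnorm_ge0 andbT.
by apply/ler_addgt0Pl => e e0; rewrite addr0 xe.
Qed.

End rnorm.

Section scalar_rnorm.
Context {R : realType}.
Implicit Types z w : R[i].

Lemma rnormM z w :
  rnorm (z * w : R[i]^o) = rnorm (z : R[i]^o) * rnorm (w : R[i]^o).
Proof. exact: (@rnormZ R R[i]^o). Qed.

Lemma rnorm_conj z : rnorm (z^* : R[i]^o) = rnorm (z : R[i]^o).
Proof. by rewrite /rnorm norm_conjC. Qed.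

Lemma rnorm_real (t : R) : 0 <= t -> rnorm (t%:C%C : R[i]^o) = t.
Proof. by move=> t0; rewrite /rnorm ger0_norm// ler0c. Qed.

Lemma ler_Re_rnorm z : `|complex.Re z| <= rnorm (z : R[i]^o).
Proof. by rewrite -lecR rnormE normc_ge_Re. Qed.

Lemma mul_conj_rnorm z : z * z^* = (rnorm (z : R[i]^o) ^+ 2)%:C%C.
Proof. by rewrite -normCK -rnormE rmorphXn. Qed.

End scalar_rnorm.

(** * Unordered sums in normed modules *)

Lemma big_fsetU_disjoint (K : choiceType) (V : nmodType) (A B : {fset K})
    (x : K -> V) : [disjoint A & B]%fset ->
  \sum_(k <- (A `|` B)%fset) x k = \sum_(k <- A) x k + \sum_(k <- B) x k.
Proof.
move=> /fdisjointP AB; rewrite -big_cat/=; apply/perm_big/uniq_perm => //.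
  rewrite cat_uniq !fset_uniq andbT/=; apply/hasPn => k kB.
  by apply/negP => /AB /negP.
by move=> k; rewrite mem_cat inE.
Qed.

Section has_sum.
Context {R : realType} {K : choiceType} {V : normedModType R[i]}.
Implicit Types (x : K -> V) (J : {fset K}).

Lemma partial_sumE x J : partial_sum x J = \sum_(k <- J) x k.
Proof. by rewrite /partial_sum big_seq_fsetE. Qed.

Lemma has_sumP x (l : V) :
  has_sum x l <-> forall e : R, 0 < e -> exists J0, forall J,
    (J0 `<=` J)%fset -> rnorm (l - \sum_(k <- J) x k) < e.
Proof.
split=> [/cvgrPdist_lt xl e e0|xl].
  have [|J0 _ J0P] := xl e%:C%C; first by rewrite ltr0c.
  exists J0 => J /J0P /=; rewrite -ltcR rnormE.
  by rewrite partial_sumE.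
apply/cvgrPdist_lt => e e0.
(* The radius [e] is an element of [R[i]]; being positive, it is real and equals its real part. *)
have eE : (complex.Re e)%:C%C = e by rewrite RRe_real// gtr0_real.
have [|J0 J0P] := xl (complex.Re e); first by rewrite -ltr0c eE.
exists J0 => // J /J0P; rewrite -ltcR rnormE eE /=.
by rewrite partial_sumE.
Qed.

Lemma has_sum_unique x (l : V) : has_sum x l -> sumK x = l.
Proof. by move=> xl; apply: cvg_lim => //; exact: norm_hausdorff. Qed.

Lemma has_sum_delta x (k : K) :
  (forall j, j != k -> x j = 0) -> has_sum x (x k).
Proof.
move=> x0; apply/has_sumP => e e0; exists [fset k]%fset => J.
rewrite fsub1set => kJ.
rewrite (big_fsetD1 k)//= big_seq big1 ?addr0 ?subrr ?rnorm0// => j.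
by rewrite !inE => /andP[/x0].
Qed.

Lemma has_sum_rnorm_le x (l : V) (M : R) :
  has_sum x l -> (forall J, rnorm (\sum_(k <- J) x k) <= M) -> rnorm l <= M.
Proof.
move=> /has_sumP xl xM; apply/ler_addgt0Pl => e e0.
have [J0 /(_ J0 (fsubset_refl _)) J0e] := xl e e0.
rewrite -(subrK (\sum_(k <- J0) x k) l).
by rewrite (le_trans (ler_rnormD _ _))// lerD// ltW.
Qed.

End has_sum.

(** Bounded additive maps are Lipschitz and so preserve limits of partial sums. Asking for
    additivity instead of linearity lets complex conjugation in, next to bounded operators, scalings
    and [inner^~ g]. *)
Lemma has_sum_map (R : realType) (K : choiceType) (V W : normedModType R[i])
    (f : V -> W) (r : R) (x : K -> V) (l : V) :
  {morph f : u v / u + v} -> (forall u, rnorm (f u) <= r * rnorm u) ->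
  has_sum x l -> has_sum (fun k => f (x k)) (f l).
Proof.
move=> fD fr /has_sumP xl; apply/has_sumP => e e0.
have f0 : f 0 = 0 by apply: (addrI (f 0)); rewrite -fD !addr0.
have fB u v : f (u - v) = f u - f v.
  by apply/eqP; rewrite eq_sym subr_eq -fD subrK.
have r0 : 0 < `|r| + 1 by rewrite ltr_wpDl.
(* The constant [r] may be zero or negative; [|r| + 1] is a positive Lipschitz constant by which one
   can divide. *)
have [|J0 J0P] := xl (e / (`|r| + 1)); first by rewrite divr_gt0.
exists J0 => J /J0P; rewrite ltr_pdivlMr// => lJ.
rewrite -(big_morph f fD f0) -fB (le_lt_trans (fr _))// (le_lt_trans _ lJ)//.
rewrite mulrC ler_wpM2l ?rnorm_ge0// (le_trans (ler_norm _))// lerDl//.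
Qed.

Lemma has_sumD (R : realType) (K : choiceType) (V : normedModType R[i])
    (x y : K -> V) (l m : V) :
  has_sum x l -> has_sum y m -> has_sum (fun k => x k + y k) (l + m).
Proof.
move=> /has_sumP xl /has_sumP ym; apply/has_sumP => e e0.
have e2 : 0 < e / 2 by rewrite divr_gt0.
have [J1 J1P] := xl _ e2; have [J2 J2P] := ym _ e2.
exists (J1 `|` J2)%fset => J; rewrite fsubUset => /andP[/J1P J1J /J2P J2J].
rewrite big_split/= opprD addrACA (le_lt_trans (ler_rnormD _ _))//.
by rewrite (splitr e) ltrD.
Qed.

Lemma has_sumZ (R : realType) (K : choiceType) (V : normedModType R[i])
    (a : R[i]) (x : K -> V) (l : V) :
  has_sum x l -> has_sum (fun k => a *: x k) (a *: l).
Proof.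
apply: (@has_sum_map _ _ _ _ _ (rnorm (a : R[i]^o))); first exact: scalerDr.
by move=> u; rewrite rnormZ.
Qed.

(** Cauchy criterion for the net of finite partial sums: for [J] containing [J0], the partial sums
    over [J] and [J0] differ by the sum over the difference set, which is disjoint from [J0]. *)
Lemma has_sum_Cauchy (R : realType) (K : choiceType)
    (V : completeNormedModType R[i]) (x : K -> V) :
  (forall e : R, 0 < e -> exists J0 : {fset K}, forall J : {fset K},
    [disjoint J0 & J]%fset -> rnorm (\sum_(k <- J) x k) < e) ->
  has_sum x (sumK x).
Proof.
move=> xC; suff : cvg (partial_sum x @ totally) by [].
apply/cauchy_cvgP/cauchy_exP => e e0.
have eE : (complex.Re e)%:C%C = e by rewrite RRe_real// gtr0_real.
have [|J0 J0P] := xC (complex.Re e); first by rewrite -ltr0c eE.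
exists (partial_sum x J0); exists J0 => // J /= J0J.
rewrite -ball_normE /= distrC -eE -rnormE ltcR !partial_sumE.
have dJ : [disjoint J0 & J `\` J0]%fset.
  by apply/fdisjointP => k kJ0; rewrite inE kJ0.
rewrite -(fsetID J0 J) (fsetIidPr J0J) big_fsetU_disjoint// addrAC subrr add0r.
exact: J0P.
Qed.

(** * Square-summable sequences *)

Section l2.
Context {R : realType} {K : countType}.
Implicit Types (c : K -> R[i]) (J : {fset K}).
Local Notation sq c k := (rnorm (c k : R[i]^o) ^+ 2).

Lemma sqsum_leP c (M : R) :
  (sqsum c <= M%:E)%E <-> forall J, \sum_(k <- J) sq c k <= M.
Proof.
split=> [cM J|cM].
  rewrite -lee_fin (le_trans _ cM)//; apply: esum_ge.
  exists [set` J]; first by split; [exact: finite_fset|].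
  by rewrite fsbig_finite ?finite_fset//= set_fsetK sumEFin.
apply: ge_ereal_sup => _ [A [finA _] <-].
by rewrite fsbig_finite//= sumEFin lee_fin.
Qed.

Lemma sqsum_ge0 c : (0 <= sqsum c)%E.
Proof. by apply: esum_ge0 => k _; rewrite lee_fin exprn_ge0// rnorm_ge0. Qed.

Lemma sqsum_fin c : l2 c -> (fine (sqsum c))%:E = sqsum c.
Proof. by move=> cl; rewrite fineK// ge0_fin_numE// sqsum_ge0. Qed.

Lemma l2norm_ge0 c : 0 <= l2norm c.
Proof. exact: sqrtr_ge0. Qed.

Lemma l2norm_sqr c : l2norm c ^+ 2 = fine (sqsum c).
Proof. by rewrite sqr_sqrtr// fine_ge0// sqsum_ge0. Qed.

Lemma l2_fsum_le c J : l2 c -> \sum_(k <- J) sq c k <= l2norm c ^+ 2.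
Proof.
by move=> cl; rewrite l2norm_sqr; apply/sqsum_leP: J; rewrite sqsum_fin.
Qed.

Lemma sqsum_le_l2 c (M : R) :
  (sqsum c <= M%:E)%E -> l2 c /\ l2norm c ^+ 2 <= M.
Proof.
move=> cM; have cl : l2 c by rewrite /l2/= (le_lt_trans cM)// ltry.
by split=> //; rewrite l2norm_sqr -lee_fin sqsum_fin.
Qed.

(** Take [J0] whose partial sum is within [e] of the supremum: a disjoint set contributing [e] or
    more would push the sum over the union past it. If no such [J0] existed, [l2norm c ^+ 2 - e]
    would already bound all partial sums. *)
Lemma l2_tail c (e : R) : l2 c -> 0 < e ->
  exists J0, forall J, [disjoint J0 & J]%fset -> \sum_(k <- J) sq c k < e.
Proof.
move=> cl e0.
have [J0 J0P] : exists J0, l2norm c ^+ 2 - e < \sum_(k <- J0) sq c k.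
  apply: contrapT => /forallNP nJ.
  suff : (sqsum c <= (l2norm c ^+ 2 - e)%:E)%E.
    by move=> /sqsum_le_l2[_]; rewrite l2norm_sqr lerDl oppr_ge0 leNgt e0.
  by apply/sqsum_leP => J; rewrite leNgt; apply/negP/nJ.
exists J0 => J dJ; have := l2_fsum_le (J0 `|` J)%fset cl.
by rewrite big_fsetU_disjoint//; lra.
Qed.

End l2.

(** * Inner products and the Cauchy-Schwarz inequality *)

Section inner_product.
Context {R : realType} {H : hilbertType R}.
Implicit Types f g h : H.

Lemma innerDl f g h : inner (f + g) h = inner f h + inner g h.
Proof. exact: linearDl. Qed.

Lemma innerZl (a : R[i]) f g : inner (a *: f) g = a * inner f g.
Proof. exact: linearZl_LR. Qed.

Lemma innerC f g : inner f g = (inner g f)^*.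
Proof. by rewrite (hermC inner f g) mul1r. Qed.

Lemma innerDr f g h : inner f (g + h) = inner f g + inner f h.
Proof. by rewrite innerC innerDl rmorphD/= -!innerC. Qed.

Lemma inner_suml (I : Type) (s : seq I) (u : I -> H) g :
  inner (\sum_(i <- s) u i) g = \sum_(i <- s) inner (u i) g.
Proof.
apply: (big_morph (fun f => inner f g)); first by move=> f h; rewrite innerDl.
by rewrite -(scale0r 0) innerZl mul0r.
Qed.

Lemma inner_rnorm f : inner f f = (rnorm f ^+ 2)%:C%C.
Proof. by rewrite inner_norm -rnormE rmorphXn. Qed.

Lemma rnorm_innerC f g :
  rnorm (inner f g : R[i]^o) = rnorm (inner g f : R[i]^o).
Proof. by rewrite innerC rnorm_conj. Qed.

Lemma innerZr (a : R[i]) f g : inner f (a *: g) = a^* * inner f g.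
Proof. by rewrite innerC innerZl rmorphM/= -innerC. Qed.

(** Serves both Cauchy-Schwarz and the contraction estimate for the frame operator. With [t] real
    the two cross terms are conjugate, so only a real part survives. *)
Lemma rnormB_sqr f g (t : R) :
  rnorm (f - t%:C%C *: g) ^+ 2 =
  rnorm f ^+ 2 - 2 * t * complex.Re (inner g f) + t ^+ 2 * rnorm g ^+ 2.
Proof.
have tJ : (- t%:C%C : R[i])^* = - t%:C%C.
  by apply/CrealP; rewrite rpredN complex_real.
have ReJ : inner g f + (inner g f)^* = 2 * (complex.Re (inner g f))%:C%C.
  exact: addcJ.
apply: complexI; rewrite -inner_rnorm [t ^+ 2]expr2.
have := inner_rnorm f; have := inner_rnorm g.
move: (rnorm f ^+ 2) (rnorm g ^+ 2) => nf ng gE fE.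
rewrite rmorphD rmorphB !rmorphM/=.
rewrite (rmorph_nat (real_complex R) 2) mulrAC -ReJ -fE -gE.
rewrite -scaleNr innerDl !innerDr !innerZl !innerZr [inner f g]innerC tJ.
by ring.
Qed.

Lemma Cauchy_Schwarz f g : rnorm (inner f g : R[i]^o) <= rnorm f * rnorm g.
Proof.
have [->|g0] := eqVneq g 0.
  by rewrite -(scale0r 0) innerZr conjC0 mul0r scale0r !rnorm0 mulr0.
have ng0 : 0 < rnorm g.
  by rewrite lt_def rnorm_ge0 andbT; apply: contra_neq g0; exact: rnorm_eq0.
set a := inner f g; set n := rnorm (a : R[i]^o).
have aE : complex.Re (inner (a *: g) f) = n ^+ 2.
  by rewrite innerZl [inner g f]innerC mul_conj_rnorm.
(* The vector is [f] minus its orthogonal projection on [g]. Putting the complex factor [a] into the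
   vector [a *: g] leaves the real coefficient that [rnormB_sqr] asks for. *)
have := sqr_ge0 (rnorm (f - ((rnorm g ^+ 2)^-1)%:C%C *: (a *: g))).
rewrite rnormB_sqr aE rnormZ -/n exprMn.
have -> : rnorm f ^+ 2 - 2 * (rnorm g ^+ 2)^-1 * n ^+ 2 +
    (rnorm g ^+ 2)^-1 ^+ 2 * (n ^+ 2 * rnorm g ^+ 2) =
    rnorm f ^+ 2 - n ^+ 2 / rnorm g ^+ 2.
  by field; rewrite gt_eqF.
rewrite subr_ge0 ler_pdivrMr ?exprn_gt0// -exprMn.
by rewrite ler_pXn2r// nnegrE ?mulr_ge0// rnorm_ge0.
Qed.

End inner_product.

Lemma ler_sqrt_sqr (R : rcfType) (a b : R) : a ^+ 2 <= b -> a <= Num.sqrt b.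
Proof.
move=> ab; rewrite (le_trans (ler_norm _))// -sqrtr_sqr ler_wsqrtr//.
Qed.

Lemma ler_rnorm_sum (R : realType) (V : normedModType R[i]) (I : Type)
    (s : seq I) (u : I -> V) :
  rnorm (\sum_(i <- s) u i) <= \sum_(i <- s) rnorm (u i).
Proof.
elim/big_rec2: _ => [|i y z _ yz]; first by rewrite rnorm0.
by rewrite (le_trans (ler_rnormD _ _))// lerD2l.
Qed.

(** * Bounded operators and series *)

Section bounded_operator.
Context {R : realType} {H1 H2 : hilbertType R} {O : H1 -> H2}.
Hypothesis OB : Bop H1 H2 O.

Lemma Bop_D : {morph O : f g / f + g}.
Proof. by case: OB => Ol _ f g; have := Ol 1 f g; rewrite !scale1r. Qed.

Lemma Bop_Z (a : R[i]) f : O (a *: f) = a *: O f.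
Proof.
case: OB => Ol _; have O0 : O 0 = 0.
  by apply: (addrI (O 0)); rewrite -Bop_D !addr0.
by have := Ol a f 0; rewrite O0 !addr0.
Qed.

Lemma Bop_bound : exists2 r : R, 0 <= r & forall f, rnorm (O f) <= r * rnorm f.
Proof.
case: OB => _ [r rP]; exists `|r| => // f.
by rewrite (le_trans (rP f))// ler_wpM2r ?rnorm_ge0// ler_norm.
Qed.

Lemma Bop_has_sum (K : choiceType) (x : K -> H1) (l : H1) :
  has_sum x l -> has_sum (fun k => O (x k)) (O l).
Proof. by have [r _ rP] := Bop_bound; apply: has_sum_map rP; exact: Bop_D. Qed.

End bounded_operator.

Lemma inner_has_sum (R : realType) (K : choiceType) (H : hilbertType R)
    (x : K -> H) (l g : H) :
  has_sum x l -> has_sum (fun k => inner (x k) g : R[i]^o) (inner l g : R[i]^o).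
Proof.
apply: (@has_sum_map _ _ _ _ (fun f => inner f g : R[i]^o) (rnorm g)).
  by move=> u v; exact: innerDl.
by move=> u; rewrite mulrC Cauchy_Schwarz.
Qed.

(** * Analysis and synthesis for Bessel sequences *)

Section Bessel.
Context {R : realType} {K : countType} {H : hilbertType R}.
Implicit Types (psi : K -> H) (c : K -> R[i]) (B : R).

(** The upper frame inequality alone: it makes analysis and synthesis bounded, and it can be checked
    for a canonical dual without first showing that the dual is a frame. *)
Definition bessel psi B := 0 < B /\
  forall f, (sqsum (analysis_op psi f) <= (B * rnorm f ^+ 2)%:E)%E.

Lemma frame_bessel psi (A B : R) : frame psi A B -> bessel psi B.
Proof. by move=> [_ B0 fP]; split=> // f; case/andP: (fP f). Qed.

Section theory.
Context {psi : K -> H} {B : R}.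
Hypothesis psiB : bessel psi B.

Lemma bessel_l2 f : l2 (analysis_op psi f).
Proof. by have [] := sqsum_le_l2 (psiB.2 f). Qed.

Lemma bessel_l2norm f : l2norm (analysis_op psi f) ^+ 2 <= B * rnorm f ^+ 2.
Proof. by have [] := sqsum_le_l2 (psiB.2 f). Qed.

(* Writing s for the sum, AM-GM gives
   2 |c k| |<s, psi k>| <= B |c k| ^ 2 + |<s, psi k>| ^ 2 / B,
   and summing, 2 |s| ^ 2 <= B \sum |c k| ^ 2 + |s| ^ 2. *)
Lemma bessel_fsum_le c (J : {fset K}) :
  rnorm (\sum_(k <- J) c k *: psi k) ^+ 2 <=
  B * \sum_(k <- J) rnorm (c k : R[i]^o) ^+ 2.
Proof.
have [B0 _] := psiB; set s := \sum_(k <- J) _.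
have s2 : rnorm s ^+ 2 <= \sum_(k <- J)
    (B * rnorm (c k : R[i]^o) ^+ 2 +
     B^-1 * rnorm (inner s (psi k) : R[i]^o) ^+ 2) / 2.
  rewrite -[leLHS]rnorm_real ?exprn_ge0 ?rnorm_ge0// -inner_rnorm.
  rewrite {1}/s inner_suml.
  rewrite (le_trans (@ler_rnorm_sum R R[i]^o _ _ _))//; apply: ler_sum => k _.
  rewrite innerZl rnormM [X in _ * X]rnorm_innerC.
  set a := rnorm (c k : R[i]^o); set b := rnorm (inner s (psi k) : R[i]^o).
  have -> : B * a ^+ 2 + B^-1 * b ^+ 2 = 2 * (a * b) + B * (a - B^-1 * b) ^+ 2.
    by field; rewrite gt_eqF.
  by rewrite ler_pdivlMr// mulrC lerDl mulr_ge0 ?sqr_ge0// ltW.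
have := l2_fsum_le J (bessel_l2 s).
move=> /le_trans/(_ (bessel_l2norm s)); rewrite /analysis_op => Js.
move: s2; rewrite -mulr_suml big_split/= -!mulr_sumr.
have : B^-1 * \sum_(k <- J) rnorm (inner s (psi k) : R[i]^o) ^+ 2
    <= rnorm s ^+ 2.
  by rewrite mulrC ler_pdivrMr// mulrC.
by lra.
Qed.

(** The estimate on finite sums, applied to sets disjoint from a large [J0], turns small tails of
    [c] into the Cauchy criterion; the tail size [e ^+ 2 / B] absorbs the factor [B]. *)
Lemma bessel_has_sum c : l2 c ->
  has_sum (fun k => c k *: psi k) (synthesis_op psi c).
Proof.
move=> cl; have [B0 _] := psiB; apply: has_sum_Cauchy => e e0.
have [|J0 J0P] := l2_tail cl (e := e ^+ 2 / B).
  by rewrite divr_gt0 ?exprn_gt0.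
exists J0 => J /J0P; rewrite ltr_pdivlMr// mulrC => cJ.
have := le_lt_trans (bessel_fsum_le c J) cJ.
by rewrite ltr_pXn2r// nnegrE ?rnorm_ge0// ltW.
Qed.

Lemma synthesis_bound c : l2 c ->
  rnorm (synthesis_op psi c) <= Num.sqrt B * l2norm c.
Proof.
move=> cl; have [B0 _] := psiB.
apply: (has_sum_rnorm_le (bessel_has_sum cl)) => J.
rewrite -(ger0_norm (l2norm_ge0 c)) -sqrtr_sqr -sqrtrM ?(ltW B0)//.
apply: ler_sqrt_sqr; apply: (le_trans (bessel_fsum_le c J)).
by rewrite ler_pM2l// l2_fsum_le.
Qed.

Lemma analysis_bound f : l2norm (analysis_op psi f) <= Num.sqrt B * rnorm f.
Proof.
have [B0 _] := psiB.
rewrite -(ger0_norm (rnorm_ge0 f)) -sqrtr_sqr -sqrtrM ?(ltW B0)//.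
exact/ler_sqrt_sqr/bessel_l2norm.
Qed.

Lemma inner_synthesis c g : l2 c ->
  has_sum (fun k => c k * inner (psi k) g : R[i]^o)
    (inner (synthesis_op psi c) g : R[i]^o).
Proof.
move=> /bessel_has_sum /(@inner_has_sum _ _ _ _ _ g).
by under eq_fun do rewrite innerZl.
Qed.

Lemma synthesis_linear (a : R[i]) c d : l2 c -> l2 d ->
  synthesis_op psi (fun k => a * c k + d k) =
  a *: synthesis_op psi c + synthesis_op psi d.
Proof.
move=> cl dl; apply: has_sum_unique.
under eq_fun do rewrite scalerDl -scalerA.
by apply: has_sumD; [apply: has_sumZ|]; exact: bessel_has_sum.
Qed.

End theory.
End Bessel.

(** * Matrices of bounded operators and operators of bounded matrices *)

Section two_spaces.
Context {R : realType} {K : countType} {H1 H2 : hilbertType R}.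
Context {psi : K -> H1} {phi : K -> H2} {B B' : R}.
Hypotheses (psiB : bessel psi B) (phiB : bessel phi B').

(** Continuity carries [O] and then the inner product inside the synthesis series. With [g] some
    [phi j] this computes a row of the matrix applied to [c], and later an entry of a matrix
    product. *)
Lemma matrix_of_has_sum (O : H1 -> H2) c (g : H2) : Bop H1 H2 O -> l2 c ->
  has_sum (fun k => inner (O (psi k)) g * c k : R[i]^o)
    (inner (O (synthesis_op psi c)) g : R[i]^o).
Proof.
move=> OB /(bessel_has_sum psiB) /(Bop_has_sum OB).
move=> /(@inner_has_sum _ _ _ _ _ g).
by under eq_fun do rewrite (Bop_Z OB) innerZl mulrC.
Qed.

Lemma matvec_matrix_of (O : H1 -> H2) c : Bop H1 H2 O -> l2 c ->
  matvec (matrix_of phi psi O) c = analysis_op phi (O (synthesis_op psi c)).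
Proof.
by move=> OB cl; apply/funext => j;
  exact: has_sum_unique (matrix_of_has_sum OB cl).
Qed.

Lemma matrix_of_Bl2 (O : H1 -> H2) : Bop H1 H2 O -> Bl2 (matrix_of phi psi O).
Proof.
move=> OB; split=> [c j cl|c cl|].
- by eexists; exact: matrix_of_has_sum.
- by rewrite matvec_matrix_of//; exact: bessel_l2 phiB _.
have [r r0 rP] := Bop_bound OB.
exists (Num.sqrt B' * (r * Num.sqrt B)) => c cl; rewrite matvec_matrix_of//.
rewrite (le_trans (analysis_bound phiB _))// -mulrA ler_wpM2l ?sqrtr_ge0//.
by rewrite (le_trans (rP _))// -mulrA ler_wpM2l// (synthesis_bound psiB).
Qed.

Lemma operator_of_Bop (M : K -> K -> R[i]) :
  Bl2 M -> Bop H1 H2 (operator_of phi psi M).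
Proof.
move=> [Ms Ml [r rP]]; split=> [a f g|].
  have fl := bessel_l2 psiB f; have gl := bessel_l2 psiB g.
  rewrite /operator_of -(synthesis_linear phiB a (Ml _ fl) (Ml _ gl)).
  congr synthesis_op; apply/funext => j; apply: (@has_sum_unique R K R[i]^o).
  (* [sumK] is a limit and is additive only on convergent series; the first clause of [Bl2] gives
     convergence of the row series. *)
  have [s sf] := Ms _ j fl; have [t tg] := Ms _ j gl.
  rewrite /matvec (has_sum_unique sf) (has_sum_unique tg).
  rewrite (_ : (fun k => _) =
      fun k => a *: (M j k * analysis_op psi f k : R[i]^o) +
               M j k * analysis_op psi g k).
    exact: has_sumD (@has_sumZ _ _ _ a _ _ sf) tg.
  by apply/funext => k; rewrite /analysis_op innerDl innerZl mulrDr mulrCA.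
exists (Num.sqrt B' * (`|r| * Num.sqrt B)) => f.
have fl := bessel_l2 psiB f.
rewrite (le_trans (synthesis_bound phiB (Ml _ fl)))// -mulrA.
rewrite ler_wpM2l ?sqrtr_ge0// (le_trans (rP _ fl))// -mulrA.
rewrite (le_trans (ler_wpM2r (l2norm_ge0 _) (ler_norm r)))// ler_wpM2l//.
exact: (analysis_bound psiB).
Qed.

End two_spaces.

(** Banach iteration of [v |-> g + T v] from 0: differences of iterates decay like [q ^+ n], and
    completeness gives the limit. *)
Lemma affine_contraction_fixpoint (R : realType) (V : completeNormedModType R[i])
    (T : V -> V) (q : R) (g : V) :
  {morph T : u v / u + v} -> 0 <= q < 1 ->
  (forall u, rnorm (T u) <= q * rnorm u) -> exists u, u = g + T u.
Proof.
move=> TD /andP[q0 q1] Tq; pose u n := iter n (fun v => g + T v) 0.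
have T0 : T 0 = 0 by apply: (addrI (T 0)); rewrite -TD !addr0.
have TB v w : T (v - w) = T v - T w.
  by apply/eqP; rewrite eq_sym subr_eq -TD subrK.
have q1' : 0 < 1 - q by rewrite subr_gt0.
(* [C] is the sum of the geometric series with first term [rnorm g], and satisfies
   [rnorm g + q * C = C]; hence it bounds every iterate. *)
pose C := rnorm g / (1 - q).
have uC n : rnorm (u n) <= C.
  elim: n => [|n IH]; first by rewrite rnorm0 divr_ge0 ?rnorm_ge0// ltW.
  rewrite (le_trans (ler_rnormD _ _))// (le_trans (lerD (lexx _) (Tq _)))//.
  rewrite (le_trans (lerD (lexx _) (ler_wpM2l q0 IH)))//.
  by rewrite /C le_eqVlt; apply/orP; left; apply/eqP; field; rewrite gt_eqF.
(* In the difference of two iterates [g] cancels, so each step back costs one application of [T],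
   down to [u m - u 0 = u m]. *)
have uq n m : rnorm (u (n + m)%N - u n) <= q ^+ n * C.
  elim: n => [|n IH]; first by rewrite subr0 mul1r uC.
  rewrite addSn [u _.+1]/= [u n.+1]/= opprD addrACA subrr add0r -TB.
  by rewrite (le_trans (Tq _))// exprS -mulrA ler_wpM2l.
have qC e : 0 < e -> exists n, q ^+ n * C < e.
  (* [C] vanishes when [g = 0], so the division is by [C + 1]. *)
  move=> e0; have C0 : 0 < C + 1.
    by rewrite ltr_wpDl// divr_ge0 ?rnorm_ge0// ltW.
  have /cvgrPdist_lt/(_ (e / (C + 1))) : q ^+ n @[n --> \oo] --> (0 : R).
    by apply: cvg_expr; rewrite ger0_norm.
  case; first by rewrite divr_gt0.
  move=> n _ /(_ n (leqnn n)) /=; rewrite sub0r normrN ger0_norm ?exprn_ge0//.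
  rewrite ltr_pdivlMr// => nC; exists n; apply: le_lt_trans nC.
  by rewrite ler_wpM2l ?exprn_ge0// lerDl.
have /cvg_ex[l ul] : cvg (u @ \oo).
  apply/cauchy_cvgP/cauchy_exP => e e0.
  have eE : (complex.Re e)%:C%C = e by rewrite RRe_real// gtr0_real.
  have [|n nP] := qC (complex.Re e); first by rewrite -ltr0c eE.
  exists (u n); exists n => // m /= nm.
  rewrite -ball_normE /= distrC -eE -rnormE ltcR -(subnKC nm).
  exact: le_lt_trans nP.
exists l; apply/eqP; rewrite -subr_eq0; apply/eqP/rnorm_small => e e0.
have /cvgrPdist_lt/(_ (e / 2)%:C%C) := ul.
case; first by rewrite ltr0c divr_gt0.
move=> n _ nP.
have n1 := nP n (leqnn n); have n2 := nP n.+1 (leqnSn n).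
rewrite /= -rnormE ltcR in n1; rewrite /= -rnormE ltcR in n2.
(* The defect of [l] passes through [u n.+1 = g + T (u n)]; each of the two pieces is at most
   [e / 2]. *)
have -> : l - (g + T l) = (l - (g + T (u n))) + T (u n - l).
  by rewrite TB opprD opprD !addrA subrK.
rewrite (le_trans (ler_rnormD _ _))// (splitr e) lerD ?(ltW n2)//.
rewrite (le_trans (Tq _))// rnormB (le_trans _ (ltW n1))//.
by rewrite ler_piMl ?rnorm_ge0// ltW.
Qed.

(** * The frame operator: boundedness, self-adjointness, coercivity, surjectivity *)

Section frame_operator.
Context {R : realType} {K : countType} {H : hilbertType R}.
Context {psi : K -> H} {A B : R}.
Hypothesis psiF : frame psi A B.
Let A0 : 0 < A. Proof. by case: psiF. Qed.
Let psiB := frame_bessel psiF.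
Let B0 : 0 < B. Proof. by case: psiF. Qed.
Local Notation S := (frame_op psi).

Lemma frame_op_bound f : rnorm (S f) <= B * rnorm f.
Proof.
rewrite (le_trans (synthesis_bound psiB (bessel_l2 psiB f)))//.
rewrite -{2}(sqr_sqrtr (ltW B0)) expr2 -mulrA ler_wpM2l ?sqrtr_ge0//.
exact: analysis_bound.
Qed.

Lemma frame_op_Bop : Bop H H S.
Proof.
split=> [a f g|]; last by exists B; exact: frame_op_bound.
rewrite -(synthesis_linear psiB _ (bessel_l2 psiB f) (bessel_l2 psiB g)).
by congr synthesis_op; apply/funext => k; rewrite /analysis_op innerDl innerZl.
Qed.

Lemma inner_frame_op f g :
  has_sum (fun k => inner f (psi k) * inner (psi k) g : R[i]^o)
    (inner (S f) g : R[i]^o).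
Proof. exact: (inner_synthesis psiB (bessel_l2 psiB f)). Qed.

(** Conjugating the series of [inner (S g) f] term by term yields the series of [inner (S f) g], and
    sums are unique. *)
Lemma frame_op_selfadjoint f g : inner (S f) g = inner f (S g).
Proof.
rewrite [RHS]innerC -(has_sum_unique (inner_frame_op (f := f) (g := g))).
apply: has_sum_unique.
have cB : forall z : R[i]^o, rnorm (z^* : R[i]^o) <= 1 * rnorm z.
  by move=> z; rewrite rnorm_conj mul1r.
have := @has_sum_map R K R[i]^o R[i]^o (fun z => z^*) 1 _ _
  (@rmorphD _ _ Num.conj) cB (inner_frame_op (f := g) (g := f)).
by under eq_fun do rewrite rmorphM/= -!innerC mulrC.
Qed.

Lemma frame_op_coercive f : A * rnorm f ^+ 2 <= complex.Re (inner (S f) f).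
Proof.
have [_ _ /(_ f)/andP[Af _]] := psiF; rewrite -lee_fin (le_trans Af)//.
apply/sqsum_leP => J; apply/ler_addgt0Pl => e e0.
have /has_sumP/(_ e e0)[J0 J0P] := inner_frame_op (f := f) (g := f).
(* Enlarging [J] to contain [J0] brings the partial sum within [e] of [inner (S f) f]; as the terms
   are squared moduli, this can only increase the sum over [J]. *)
have /J0P : (J0 `<=` J `|` J0)%fset by rewrite fsubsetUr.
set s := \sum_(k <- _) _ => se.
have sE : complex.Re s =
    \sum_(k <- (J `|` J0)%fset) rnorm (inner f (psi k) : R[i]^o) ^+ 2.
  rewrite /s (eq_bigr (fun k =>
      (rnorm (inner f (psi k) : R[i]^o) ^+ 2)%:C%C)) => [|k _].
    by rewrite -(rmorph_sum (real_complex R)).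
  by rewrite [inner (psi k) f]innerC mul_conj_rnorm.
have : \sum_(k <- J) rnorm (inner f (psi k) : R[i]^o) ^+ 2 <= complex.Re s.
  rewrite sE (_ : J `|` J0 = J `|` (J0 `\` J))%fset; last first.
    by rewrite fsetUDl fsetDv fsetD0.
  have dJ : [disjoint J & J0 `\` J]%fset.
    by apply/fdisjointP => k kJ; rewrite inE kJ.
  by rewrite big_fsetU_disjoint// lerDl sumr_ge0// => k _; rewrite sqr_ge0.
have := le_lt_trans (ler_Re_rnorm _) se; rewrite raddfB/=.
rewrite ltr_norml => /andP[? _]; rewrite /analysis_op; lra.
Qed.

Lemma frame_op_surj g : exists f, S f = g.
Proof.
pose t := A / B ^+ 2.
have t0 : 0 < t by rewrite divr_gt0// exprn_gt0.
have SB := frame_op_Bop.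
pose T f := f - t%:C%C *: S f.
have TD : {morph T : u v / u + v}.
  by move=> u v; rewrite /T (Bop_D SB) scalerDr opprD addrACA.
(* If [B < A], which forces the space to be zero, the radicand is negative and [Num.sqrt] returns 0,
   so [q] stays in the required range. *)
pose q := Num.sqrt (1 - A ^+ 2 / B ^+ 2).
have q1 : 0 <= q < 1.
  rewrite sqrtr_ge0/= -[ltRHS]sqrtr1 ltr_sqrt// ltrBlDl ltrDr.
  by rewrite divr_gt0// exprn_gt0.
have Tq f : rnorm (T f) <= q * rnorm f.
  rewrite mulrC -(ger0_norm (rnorm_ge0 f)) -sqrtr_sqr -sqrtrM ?sqr_ge0//.
  apply: ler_sqrt_sqr; rewrite rnormB_sqr.
  have h1 := ler_wpM2l (ltW t0) (frame_op_coercive f).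
  have h2 : rnorm (S f) ^+ 2 <= B ^+ 2 * rnorm f ^+ 2.
    rewrite -exprMn lerXn2r ?nnegrE ?rnorm_ge0 ?frame_op_bound//.
    by rewrite mulr_ge0 ?rnorm_ge0// ltW.
  have {h2}h2 := ler_wpM2l (sqr_ge0 t) h2.
  have -> : rnorm f ^+ 2 * (1 - A ^+ 2 / B ^+ 2) =
      rnorm f ^+ 2 - 2 * (t * (A * rnorm f ^+ 2)) +
      t ^+ 2 * (B ^+ 2 * rnorm f ^+ 2).
    by rewrite /t; field; rewrite gt_eqF.
  lra.
have [f fE] := affine_contraction_fixpoint (t%:C%C *: g) TD q1 Tq.
exists f; have tf : t%:C%C *: S f = t%:C%C *: g.
  move: fE; rewrite /T addrCA -{1}[f]addr0 => /addrI/esym/eqP.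
  by rewrite subr_eq0 => /eqP.
by apply: scalerI tf; rewrite gt_eqF// ltr0c.
Qed.

End frame_operator.

(** * Inverse frame operator, canonical dual and reconstruction *)

Section canonical_dual.
Context {R : realType} {K : countType} {H : hilbertType R}.
Context {psi : K -> H} {A B : R}.
Hypothesis psiF : frame psi A B.
Local Notation S := (frame_op psi).
Local Notation T := ('pinv_(fun=> 0) [set: H] S).
Let A0 : 0 < A. Proof. by case: psiF. Qed.
Let B0 : 0 < B. Proof. by case: psiF. Qed.
Let psiB := frame_bessel psiF.
Let SB := frame_op_Bop psiF.

Lemma frame_opK g : S (T g) = g.
Proof.
have [f fg] := frame_op_surj psiF g.
by apply: (@pinvK _ _ _ [set: H] S g); rewrite inE; exists f.
Qed.

(** Coercivity and Cauchy-Schwarz, divided by [rnorm f]. It yields both injectivity of [S] and the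
    bound [A^-1] on its inverse. *)
Lemma frame_op_lower f : A * rnorm f <= rnorm (S f).
Proof.
have [->|f0] := eqVneq f 0; first by rewrite rnorm0 mulr0 rnorm_ge0.
have nf0 : 0 < rnorm f.
  by rewrite lt_def rnorm_ge0 andbT; apply: contra_neq f0; exact: rnorm_eq0.
rewrite -(ler_pM2r nf0) -mulrA -expr2 (le_trans (frame_op_coercive psiF f))//.
rewrite (le_trans (ler_norm _))// (le_trans (ler_Re_rnorm _))//.
exact: Cauchy_Schwarz.
Qed.

Lemma frame_op_inj : injective S.
Proof.
move=> f g fg; apply/eqP; rewrite -subr_eq0; apply/eqP/rnorm_eq0/eqP.
rewrite eq_le rnorm_ge0 andbT -(ler_pM2l A0) mulr0.
rewrite (le_trans (frame_op_lower _))//.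
by rewrite -scaleN1r (Bop_D SB) (Bop_Z SB) fg scaleN1r subrr rnorm0.
Qed.

Lemma pinv_frame_op_bound g : rnorm (T g) <= A^-1 * rnorm g.
Proof. by rewrite ler_pdivlMl// -{2}(frame_opK g) frame_op_lower. Qed.

Lemma pinv_frame_op_Bop : Bop H H T.
Proof.
split=> [a f g|]; last by exists A^-1; exact: pinv_frame_op_bound.
by apply: frame_op_inj; rewrite (Bop_D SB) (Bop_Z SB) !frame_opK.
Qed.

(** Write [f] as [S (T f)] and move [S] across the inner product, where it cancels the [T] in the
    dual vector. Analysis by the dual is thus analysis by [psi] after [T]. *)
Lemma analysis_canonical_dual f :
  analysis_op (canonical_dual psi) f = analysis_op psi (T f).
Proof.
apply/funext => k; rewrite /analysis_op /canonical_dual.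
by rewrite -{1}(frame_opK f) (frame_op_selfadjoint psiF) frame_opK.
Qed.

Lemma bessel_canonical_dual : bessel (canonical_dual psi) (B / A ^+ 2).
Proof.
(* The factor [B] is the Bessel bound of [psi], and [A ^- 2] comes from the squared norm bound on
   [T]. *)
split=> [|f]; first by rewrite divr_gt0// exprn_gt0.
rewrite analysis_canonical_dual (le_trans (psiB.2 _))// lee_fin.
rewrite -mulrA ler_wpM2l ?(ltW B0)// -exprVn -exprMn.
rewrite lerXn2r ?nnegrE ?rnorm_ge0 ?pinv_frame_op_bound//.
by rewrite mulr_ge0 ?rnorm_ge0// invr_ge0 ltW.
Qed.

Lemma synthesis_dual f :
  synthesis_op psi (analysis_op (canonical_dual psi) f) = f.
Proof. by rewrite analysis_canonical_dual [LHS]frame_opK. Qed.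

(** The bounded operator [T] is applied term by term to the series defining [S f]. *)
Lemma dual_synthesis f :
  synthesis_op (canonical_dual psi) (analysis_op psi f) = f.
Proof.
have := Bop_has_sum pinv_frame_op_Bop (bessel_has_sum psiB (bessel_l2 psiB f)).
have -> : T (synthesis_op psi (analysis_op psi f)) = f.
  by apply: frame_op_inj; rewrite frame_opK.
under eq_fun do rewrite (Bop_Z pinv_frame_op_Bop).
exact: has_sum_unique.
Qed.

End canonical_dual.

(** The composite is synthesis by [phi], analysis by [phi'], [O], synthesis by [psi'], analysis by
    [psi], and both outer pairs cancel. Stating it for arbitrary reconstructing pairs covers both
    orders of frame and dual, so the dual of the dual never has to be computed. *)
Lemma operator_of_matrix_ofK (R : realType) (K : countType)
    (H1 H2 : hilbertType R)
    (psi psi' : K -> H1) (phi phi' : K -> H2) (B B' : R)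
    (O : H1 -> H2) :
  bessel psi B -> bessel psi' B' ->
  (forall f, synthesis_op psi' (analysis_op psi f) = f) ->
  (forall f, synthesis_op phi (analysis_op phi' f) = f) ->
  Bop H1 H2 O -> operator_of phi psi (matrix_of phi' psi' O) = O.
Proof.
move=> psiB psiB' psiK phiK OB; apply/funext => f.
by rewrite /operator_of (matvec_matrix_of psiB' OB (bessel_l2 psiB f)) psiK phiK.
Qed.

Lemma matvec_idmat (R : realType) (K : countType) (c : K -> R[i]) :
  matvec idmat c = c.
Proof.
apply/funext => j; rewrite -[RHS]mul1r.
have {1}-> : (1 : R[i]) = idmat j j by rewrite /idmat eqxx.
apply: (@has_sum_unique R K R[i]^o).
apply: (@has_sum_delta R K R[i]^o (fun k => idmat j k * c k)) => k kj.
by rewrite /idmat eq_sym (negPf kj) mul0r.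
Qed.

Theorem proposition3p2 (R : realType) (K : countType) (H1 H2 : hilbertType R)
    (infH1 : infinite_dim H1) (infH2 : infinite_dim H2)
    (psi : K -> H1) (phi : K -> H2) (A B A' B' : R)
    (psiF : frame psi A B) (phiF : frame phi A' B') :
  let psi' := canonical_dual psi in
  let phi' := canonical_dual phi in
  (* the maps are well defined between the spaces of bounded operators *)
  [/\ set_fun (Bop H1 H2) Bl2 (matrix_of phi psi),
      set_fun (Bop H1 H2) Bl2 (matrix_of phi' psi'),
      set_fun Bl2 (Bop H1 H2) (operator_of phi psi) &
      set_fun Bl2 (Bop H1 H2) (operator_of phi' psi')] /\
  (* 1 *)
  (forall O : H1 -> H2, Bop H1 H2 O ->
    [/\ operator_of phi psi (matrix_of phi' psi' O) = O,
        operator_of phi' psi' (matrix_of phi psi O) = O &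
        forall f : H1, exists2 c : K -> R[i],
          forall k, has_sum
            (fun j => inner (O (psi' j)) (phi' k) * inner f (psi j) : R[i]^o)
            (c k) &
          has_sum (fun k => c k *: phi k) (O f)]) /\
  (* 2 *)
  (set_inj (Bop H1 H2) (matrix_of phi psi) /\
   set_surj Bl2 (Bop H1 H2) (operator_of phi psi)) /\
  (* 3 *)
  operator_of psi psi' idmat = id /\
  (* 4 *)
  (forall (H3 : hilbertType R) (infH3 : infinite_dim H3)
      (xi : K -> H3) (A3 B3 : R) (xiF : frame xi A3 B3)
      (O : H3 -> H2) (P : H1 -> H3),
    let xi' := canonical_dual xi in
    Bop H3 H2 O -> Bop H1 H3 P ->
    [/\ Bl2 (matrix_of phi xi O), Bl2 (matrix_of xi' psi P) &
        matrix_of phi psi (O \o P) =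
        matprod (matrix_of phi xi O) (matrix_of xi' psi P)]).
Proof.
move=> psi' phi'.
have psiB := frame_bessel psiF; have phiB := frame_bessel phiF.
have psiB' : bessel psi' _ := bessel_canonical_dual psiF.
have phiB' : bessel phi' _ := bessel_canonical_dual phiF.
have OMK O : Bop H1 H2 O -> operator_of phi psi (matrix_of phi' psi' O) = O.
  exact: (operator_of_matrix_ofK psiB psiB'
    (dual_synthesis psiF) (synthesis_dual phiF)).
have OMK' O : Bop H1 H2 O -> operator_of phi' psi' (matrix_of phi psi O) = O.
  exact: (operator_of_matrix_ofK psiB' psiB
    (synthesis_dual psiF) (dual_synthesis phiF)).
have M' O : Bop H1 H2 O -> Bl2 (matrix_of phi' psi' O).
  exact: (matrix_of_Bl2 psiB' phiB').
split; first split.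
- by move=> O; exact: (matrix_of_Bl2 psiB phiB).
- exact: M'.
- by move=> M; exact: (operator_of_Bop psiB phiB).
- by move=> M; exact: (operator_of_Bop psiB' phiB').
split; first move=> U UB.
  split; [exact: OMK|exact: OMK'|move=> f].
  (* The inner sums are the coefficients of [U f] against [phi']: expand [f] in the vectors [psi']
     and apply [U]. *)
  exists (analysis_op phi' (U f)) => [k|].
    have := matrix_of_has_sum psiB' (g := phi' k) UB (bessel_l2 psiB f).
    by rewrite (dual_synthesis psiF).
  have := bessel_has_sum phiB (bessel_l2 phiB' (U f)).
  by rewrite (synthesis_dual phiF).
split; first split.
(* Injectivity comes from the left inverse [operator_of phi' psi']; surjectivity, next, from the
   right inverse [matrix_of phi' psi']. *)
- move=> O O1 /set_mem OB /set_mem OB1 OO1.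
  by rewrite -(OMK' _ OB) -(OMK' _ OB1) OO1.
- by move=> O OB; exists (matrix_of phi' psi' O); [exact: M'|exact: OMK].
split.
  by apply/funext => f; rewrite /operator_of matvec_idmat (synthesis_dual psiF).
move=> X3 infX3 xi A3 B3 xiF O P xi' OB PB.
have xiB := frame_bessel xiF.
have xiB' : bessel xi' _ := bessel_canonical_dual xiF.
split; [exact: (matrix_of_Bl2 xiB phiB)|exact: (matrix_of_Bl2 psiB xiB')|].
apply/funext => m; apply/funext => n; apply/esym.
(* Expand [P (psi n)] in the vectors [xi] with coefficients against [xi'], then apply [O] and pair
   with [phi m]: the resulting series is the entry of the matrix product. *)
have := matrix_of_has_sum xiB (g := phi m) OB (bessel_l2 xiB' (P (psi n))).
by rewrite (synthesis_dual xiF); exact: has_sum_unique.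
Qed.
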